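(* Let $t$, $d$, $N$ be positive integers. If there is a weighted Gaussian $t$-design in $\mathbb{R}^d$ with $N$ points, then there is a weighted spherical $t$-design in $\mathbb{R}^d$ with at most $2N$ points.
   Context: Let $\mu$ be the Lebesgue (surface) measure on the unit sphere $S^{d-1}\subset\mathbb{R}^d$ normalized so that $\mu(S^{d-1})=1$, and let $\rho$ be the Gaussian probability measure $d\rho=e^{-\pi|x|^2}\,dx$ on $\mathbb{R}^d$. A weighted spherical $t$-design in $\mathbb{R}^d$ is a finite set $X\subset S^{d-1}$ with a weight function $w\colon X\to\mathbb{R}_{>0}$ such that $\sum_{x\in X}w(x)f(x)=\int_{S^{d-1}}f\,d\mu$ for every polynomial $f$ of total degree at most $t$. A weighted Gaussian $t$-design in $\mathbb{R}^d$ is a finite set $X\subset\mathbb{R}^d$ with a weight function $w\colon X\to\mathbb{R}_{>0}$ such that $\sum_{x\in X}w(x)f(x)=\int_{\mathbb{R}^d}f\,d\rho$ for every polynomial $f$ of total degree at most $t$. *)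

(* Defs.v *)
From HB Require Import structures.
From mathcomp Require Import all_boot all_order all_algebra finmap.
(* The notations of mpoly clash with those of MathComp-Analysis. *)
From mathcomp.multinomials Require Import -(notations) mpoly.
From mathcomp Require Import all_classical all_reals all_analysis.
From mathcomp Require Import measurable_realfun.

Set Implicit Arguments.
Unset Strict Implicit.
Unset Printing Implicit Defensive.
Import Order.TTheory GRing.Theory Num.Theory.
Import numFieldNormedType.Exports.
Local Open Scope classical_set_scope.
Local Open Scope ring_scope.

(* Points of R^d are d-tuples, since [d.-tuple R] carries the product (Borel)
   sigma-algebra in MathComp-Analysis. *)

Section lebesgue_tuple.
Context {R : realType}.

Definition cons_pair (n : nat) (p : R * n.-tuple R) : n.+1.-tuple R :=
  [the n.+1.-tuple R of p.1 :: p.2].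

Lemma measurable_cons_pair n : measurable_fun setT (@cons_pair n).
Proof. exact: measurable_cons. Qed.

Section step.
Variables (n : nat) (m : {sigma_finite_measure set (n.-tuple R) -> \bar R}).

Definition lebesgue_cons : set (n.+1.-tuple R) -> \bar R :=
  pushforward (@lebesgue_measure R \x m)%E (@cons_pair n).

Let lebesgue_cons0 : lebesgue_cons set0 = 0%E.
Proof. apply: measure0; exact: measurable_cons_pair. Qed.

Let lebesgue_cons_ge0 A : (0 <= lebesgue_cons A)%E.
Proof. apply: measure_ge0; exact: measurable_cons_pair. Qed.

Let lebesgue_cons_sigma_additive : semi_sigma_additive lebesgue_cons.
Proof. apply: measure_semi_sigma_additive; exact: measurable_cons_pair. Qed.

HB.instance Definition _ := isMeasure.Build _ _ _ lebesgue_cons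
  lebesgue_cons0 lebesgue_cons_ge0 lebesgue_cons_sigma_additive.

Lemma lebesgue_consE (A : set R) (B : set (n.-tuple R)) :
  measurable A -> measurable B ->
  lebesgue_cons [set x | A (thead x) /\ B [tuple of behead x]] =
  (lebesgue_measure A * m B)%E.
Proof.
move=> mA mB; rewrite -product_measure1E// /lebesgue_cons /pushforward.
congr product_measure1; apply/seteqP; split => -[a b] /=;
  by rewrite theadE (_ : [tuple of _] = b)//; exact/val_inj.
Qed.

Lemma lebesgue_cons_sigma_finite : sigma_finite setT lebesgue_cons.
Proof.
have /sigma_finiteP[F [FT Fmono Ffin]] := sigma_finiteT (@lebesgue_measure R).
have /sigma_finiteP[G [GT Gmono Gfin]] := sigma_finiteT m.
exists (fun k => [set x : n.+1.-tuple R |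
    F k (thead x) /\ G k [tuple of behead x]]).
  apply/esym; rewrite -subTset => x _.
  have [i _ Fi] : (\bigcup_i F i) (thead x) by rewrite -FT.
  have [j _ Gj] : (\bigcup_i G i) [tuple of behead x] by rewrite -GT.
  exists (maxn i j) => //=; split.
    by move: Fi; apply/subsetPset/Fmono/leq_maxl.
  by move: Gj; apply/subsetPset/Gmono/leq_maxr.
move=> k; have [mF Foo] := Ffin k; have [mG Goo] := Gfin k; split; last first.
  by rewrite lebesgue_consE// lte_mul_pinfty// ge0_fin_numE.
apply: measurableI.
- rewrite -[X in measurable X]setTI.
  exact: (@measurable_tnth _ R n.+1 ord0).
- rewrite -[X in measurable X]setTI.
  exact: (@measurable_behead _ R n).
Qed.

HB.instance Definition _ := Measure_isSigmaFinite.Build _ _ _ lebesgue_cons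
  lebesgue_cons_sigma_finite.

End step.

(* Lebesgue measure on R^n, as the n-fold product of Lebesgue measure on R. *)
Fixpoint lebesgue_tuple (n : nat) :
    {sigma_finite_measure set (n.-tuple R) -> \bar R} :=
  match n with
  | 0 => [the {sigma_finite_measure set (0.-tuple R) -> \bar R} of
           dirac [tuple]]
  | n'.+1 => [the {sigma_finite_measure set (n'.+1.-tuple R) -> \bar R} of
               lebesgue_cons (lebesgue_tuple n')]
  end.

Lemma measurable_cube n (A : set R) : measurable A ->
  measurable [set x : n.-tuple R | forall i, A (tnth x i)].
Proof.
move=> mA; rewrite (_ : [set _ | _] = \bigcap_(i in [set: 'I_n])
    ((fun x : n.-tuple R => tnth x i) @^-1` A)); last first.
  by apply/seteqP; split => x /= h i; [move=> _|]; exact: h.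
apply: fin_bigcap_measurable => // i _.
rewrite -[X in measurable X]setTI; exact: measurable_tnth.
Qed.

Lemma lebesgue_cube n (A : set R) (l : R) : measurable A ->
  lebesgue_measure A = l%:E ->
  lebesgue_tuple n [set x | forall i, A (tnth x i)] = (l ^+ n)%:E.
Proof.
move=> mA lA; elim: n => [|n ih].
  by rewrite /= diracE mem_set// => -[].
rewrite exprS EFinM -ih -lA -lebesgue_consE//; last exact: measurable_cube.
have tnth_behead (x : n.+1.-tuple R) j :
    tnth x (lift ord0 j) = tnth [tuple of behead x] j.
  by rewrite {1}(tuple_eta x) tnthS.
congr (lebesgue_cons _ _); apply/seteqP; split => x /=.
- by move=> h; split=> [|i]; [exact: h|rewrite -tnth_behead; exact: h].
- move=> [h0 h] i; have [j ->|->//] := unliftP ord0 i.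
  by rewrite tnth_behead; exact: h.
Qed.

End lebesgue_tuple.

Section surface_measure.
Context {R : realType} (d : nat).
Implicit Types x : d.-tuple R.

Definition enorm x : R := Num.sqrt (\sum_(i < d) tnth x i ^+ 2).

Definition sphere : set (d.-tuple R) := [set x | enorm x = 1].

Lemma measurable_enorm : measurable_fun setT enorm.
Proof.
rewrite (_ : enorm = (fun y => y `^ 2^-1) \o
    (fun x => \sum_(i < d) tnth x i ^+ 2)); last first.
  apply/funext => x /=; rewrite powR12_sqrt// sumr_ge0// => i _.
  exact: sqr_ge0.
apply: measurableT_comp; first exact: measurable_powR.
apply: measurable_sum => i; apply: measurable_funX; exact: measurable_tnth.
Qed.

(* The direction x / |x| of x, with value 0 at x = 0. *)
Definition direction x : d.-tuple R := [tuple tnth x i / enorm x | i < d].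

Lemma measurable_direction : measurable_fun setT direction.
Proof.
apply/measurable_fun_tnthP => i.
rewrite (_ : _ \o _ = fun x => tnth x i * (enorm x `^ (-1))).
  apply: measurable_funM; first exact: measurable_tnth.
  exact: (measurableT_comp (measurable_powR _) measurable_enorm).
by apply/funext => x /=; rewrite tnth_mktuple powR_inv1// sqrtr_ge0.
Qed.

Definition punctured_ball : set (d.-tuple R) := [set x | 0 < enorm x < 1].

Lemma measurable_punctured_ball : measurable punctured_ball.
Proof.
rewrite (_ : punctured_ball = enorm @^-1` `]0, 1[); last first.
  by apply/seteqP; split => x; rewrite /= in_itv.
rewrite -[X in measurable X]setTI; exact: measurable_enorm.
Qed.

(* Surface measure in polar coordinates: A has surface area d times the volume
   of the open cone over A (without apex) inside the unit ball. As a measure on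
   R^d it is carried by [sphere]. *)
Definition surface_measure (A : set (d.-tuple R)) : \bar R :=
  (d%:R%:E * lebesgue_tuple d
    [set x | (0 < enorm x < 1)%R /\ A (direction x)])%E.

Let surface_measureE : surface_measure =
  pushforward (mrestr (mscale (d%:R%:nng : {nonneg R}) (lebesgue_tuple d))
    measurable_punctured_ball) direction.
Proof.
apply/funext => A; rewrite /pushforward /mrestr /mscale /=; congr (_ * _)%E.
by congr (lebesgue_tuple d _); apply/seteqP; split => x /= [].
Qed.

Let surface_measure0 : surface_measure set0 = 0%E.
Proof.
rewrite surface_measureE; apply: measure0; exact: measurable_direction.
Qed.

Let surface_measure_ge0 A : (0 <= surface_measure A)%E.
Proof.
rewrite surface_measureE; apply: measure_ge0; exact: measurable_direction.
Qed.

Let surface_measure_sigma_additive : semi_sigma_additive surface_measure.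
Proof.
rewrite surface_measureE.
apply: measure_semi_sigma_additive; exact: measurable_direction.
Qed.

HB.instance Definition _ := isMeasure.Build _ _ _ surface_measure
  surface_measure0 surface_measure_ge0 surface_measure_sigma_additive.

End surface_measure.

Section sphere_measure.
Context {R : realType} (d : nat).
Implicit Types x : d.-tuple R.

Lemma surface_measure_carrier :
  @surface_measure R d (~` @sphere R d) = 0%E.
Proof.
rewrite /surface_measure (_ : [set _ | _] = set0) ?measure0 ?mule0//.
apply/seteqP; split => // x /= [/andP[x0 _]]; apply.
rewrite /sphere /= {1}/enorm; under eq_bigr do rewrite tnth_mktuple expr_div_n.
have S0 : 0 <= \sum_(i < d) tnth x i ^+ 2.
  by apply: sumr_ge0 => i _; exact: sqr_ge0.
rewrite -mulr_suml -(sqr_sqrtr S0) -/(enorm x) divff ?sqrtr1//.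
by rewrite expf_eq0/= gt_eqF.
Qed.

Lemma surface_measure_gt0_lty : (0 < d)%N ->
  (0 < @surface_measure R d setT < +oo)%E.
Proof.
move=> d0; rewrite /surface_measure.
rewrite (_ : [set _ | _] = @punctured_ball R d); last first.
  by apply/seteqP; split => x //= [].
have mB := @measurable_punctured_ball R d.
apply/andP; split.
- rewrite mule_gt0 ?lte_fin ?ltr0n//.
  pose Q := [set x : d.-tuple R | forall i, `]0, d%:R^-1[%classic (tnth x i)].
  have mQ : measurable Q by exact: measurable_cube.
  have QE : lebesgue_tuple d Q = ((d%:R^-1) ^+ d)%:E.
    apply: lebesgue_cube => //.
    by rewrite lebesgue_measure_itv/= lte_fin invr_gt0 ltr0n d0 oppr0 addr0.
  apply: (@lt_le_trans _ _ (lebesgue_tuple d Q)).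
    by rewrite QE lte_fin exprn_gt0// invr_gt0 ltr0n.
  apply: le_measure; rewrite ?inE// => x Qx.
  have xi0 i : 0 < tnth x i by have := Qx i; rewrite /= in_itv/= => /andP[].
  have xi1 i : tnth x i < d%:R^-1
    by have := Qx i; rewrite /= in_itv/= => /andP[].
  rewrite /punctured_ball /= /enorm sqrtr_gt0; apply/andP; split.
    rewrite (bigD1 (Ordinal d0))//= ltr_pwDl ?exprn_gt0//.
    by rewrite sumr_ge0// => i _; rewrite sqr_ge0.
  rewrite -[ltRHS]sqrtr1 ltr_sqrt//.
  apply: (@lt_le_trans _ _ (\sum_(i < d) d%:R^-1)).
    apply: ltr_sum => [|i _]; first by apply/hasP; exists (Ordinal d0).
    apply: le_lt_trans (xi1 i); rewrite expr2 ler_piMl ?(ltW (xi0 i))//.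
    by rewrite (le_trans (ltW (xi1 i)))// invf_le1 ?ltr0n ?ler1n.
  by rewrite sumr_const card_ord -[_ *+ _]mulr_natl divff// pnatr_eq0 -lt0n.
- rewrite lte_mul_pinfty ?lee_fin//.
  pose Q := [set x : d.-tuple R | forall i, `[-1, 1]%classic (tnth x i)].
  have mQ : measurable Q by exact: measurable_cube.
  have QE : lebesgue_tuple d Q = (2%:R ^+ d)%:E.
    apply: lebesgue_cube => //.
    rewrite lebesgue_measure_itv/= lte_fin (lt_trans (ltrN10 _))//.
    by rewrite opprK.
  apply: (@le_lt_trans _ _ (lebesgue_tuple d Q)); last by rewrite QE ltry.
  apply: le_measure; rewrite ?inE// => x /andP[_ x1] i.
  rewrite /= in_itv/= -ler_norml -sqrtr_sqr (le_trans _ (ltW x1))//.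
  rewrite /enorm ler_wsqrtr// (bigD1 i)//= lerDl.
  by rewrite sumr_ge0// => j _; rewrite sqr_ge0.
Qed.

(* For 0 < d this is surface_measure / surface_measure setT: by
   [surface_measure_gt0_lty], [mnormalize] does not fall back on its second
   argument, a default for null or infinite measures. *)
Definition sphere_measure : probability (d.-tuple R) R :=
  mnormalize (@surface_measure R d)
    (@dirac _ (d.-tuple R) [tuple 0 | _ < d] R).

End sphere_measure.

Section gaussian_measure.
Context {R : realType} (d : nat).
Implicit Types x : d.-tuple R.

Definition gaussian_measure (A : set (d.-tuple R)) : \bar R :=
  (\int[lebesgue_tuple d]_(x in A) (expR (- (pi * enorm x ^+ 2)))%:E)%E.

Let gaussian0 : gaussian_measure set0 = 0%E.
Proof. by rewrite /gaussian_measure integral_set0. Qed.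

Let gaussian_ge0 A : (0 <= gaussian_measure A)%E.
Proof.
by apply: integral_ge0 => x _; rewrite lee_fin expR_ge0.
Qed.

Let gaussian_sigma_additive : semi_sigma_additive gaussian_measure.
Proof.
move=> /= F mF tF mUF; rewrite /gaussian_measure; apply: cvg_toP.
  apply: ereal_nondecreasing_is_cvgn => m n mn.
  apply: lee_sum_nneg_natr => // k _ _; apply: integral_ge0 => /= x Fkx.
  by rewrite lee_fin expR_ge0.
rewrite ge0_integral_bigcup//=.
apply/measurable_funTS/measurableT_comp => //.
apply: measurableT_comp => //; apply: measurableT_comp => //.
apply: measurable_funM => //; apply: measurable_funX.
exact: measurable_enorm.
Qed.

HB.instance Definition _ := isMeasure.Build _ _ _ gaussian_measure
  gaussian0 gaussian_ge0 gaussian_sigma_additive.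

End gaussian_measure.

Section designs.
Context {R : realType} (d : nat).
Implicit Types x : d.-tuple R.

(* [msize p] is the total degree of p plus one, and 0 for p = 0. *)
Definition deg_le (t : nat) (p : mpoly d R) : Prop := (msize p <= t.+1)%N.

Definition peval (p : mpoly d R) x : R := meval (tnth x) p.

(* Only the values of the weight function on X matter. *)
Definition spherical_design (t : nat) (X : {fset d.-tuple R})
    (w : d.-tuple R -> R) : Prop :=
  [/\ forall x, x \in X -> sphere x,
      forall x, x \in X -> 0 < w x
    & forall p, deg_le t p ->
      (\sum_(x <- X) w x * peval p x)%:E =
      (\int[sphere_measure d]_(x in @sphere R d) (peval p x)%:E)%E].

Definition gaussian_design (t : nat) (X : {fset d.-tuple R})
    (w : d.-tuple R -> R) : Prop :=
  (forall x, x \in X -> 0 < w x) /\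
  (forall p, deg_le t p ->
    (\sum_(x <- X) w x * peval p x)%:E =
    (\int[@gaussian_measure R d]_x (peval p x)%:E)%E).

End designs.

(* Main.v *)
Require Import Defs.
From HB Require Import structures.
From mathcomp Require Import all_boot all_order all_algebra finmap.
From mathcomp.multinomials Require Import -(notations) mpoly.
From mathcomp Require Import all_classical all_reals all_analysis.
From mathcomp Require Import measurable_realfun.
From mathcomp Require Import ring zify.

(** Let s = 2k be the largest even number with s <= t. A Gaussian design
    integrates homogeneous polynomials of degree s exactly, and in polar
    coordinates the Gaussian integral of such a polynomial f is
    C * (the mean of f over the sphere), where C is the Gaussian integral of
    |x|^s ([integral_gaussian_polar]). So projecting each nonzero point x of the
    design to x / |x| with weight w(x) |x|^s / C gives a formula on the sphere
    that is exact for homogeneous polynomials of degree s. On the sphere, an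
    even monomial of degree at most s agrees with its product by a power of
    |x|^2 that has degree s, so the formula is exact for all even monomials of
    degree at most t ([gaussian_design_moments]). Splitting every weight equally
    between x / |x| and - x / |x| does not affect even monomials and makes odd
    ones sum to zero, which is also their mean by symmetry: this doubles the
    number of points and gives a t-design
    ([spherical_design_of_even_monomials]).

    For t = 1 the degree s is zero and the design may consist of the origin
    alone, which has no direction; there a pair of antipodal points is a
    design of the right size ([exists_spherical_1design]).

    The analytic core is the separation of radius and direction,
    [ge0_integral_polar]. No Jacobian is computed: all that is used is how
    Lebesgue measure behaves under homotheties ([ge0_integral_scalet]) and
    Tonelli's theorem. For a function g of the direction and functions h, psi of
    the radius, three rescalings in the product of the integrals of g h and of
    psi move h to the second factor and leave a first factor that does not
    depend on h ([polar_exchange]). Let psi be the indicator of the unit ball: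
    the case h = psi shows that this first factor is the integral of g over the
    ball, which is what defines the measure of the sphere. *)

Set Implicit Arguments.
Unset Strict Implicit.
Unset Printing Implicit Defensive.
Import Order.TTheory GRing.Theory Num.Theory.
Import numFieldNormedType.Exports.
Local Open Scope classical_set_scope.
Local Open Scope ring_scope.

(** * Integrals against a measure given by a density and a map *)

Section change_of_variables.
Local Open Scope ereal_scope.
Context d1 d2 (S : measurableType d1) (T : measurableType d2) (R : realType).
Variables (mu : {measure set S -> \bar R}) (nu : {measure set T -> \bar R}).
Variables (phi : S -> T) (k : S -> R).
Hypotheses (mphi : measurable_fun setT phi) (mk : measurable_fun setT k).
Hypothesis k0 : forall x, (0 <= k x)%R.
Hypothesis nuE : forall A, measurable A ->
  nu A = \int[mu]_x (\1_A (phi x) * k x)%:E.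

Import HBNNSimple.

(** The hypothesis [nuE] is the case of indicators; it extends to simple
    functions by linearity and to f by monotone convergence. One statement
    serves for densities (phi the identity) and for images of a measure
    (k constant), and for the measure of the sphere, where both occur. *)
Lemma ge0_integral_density_pushforward (f : T -> \bar R) :
  measurable_fun setT f -> (forall y, 0 <= f y) ->
  \int[nu]_y f y = \int[mu]_x (f (phi x) * (k x)%:E).
Proof.
move=> mf f0.
pose f_ := nnsfun_approx measurableT mf.
have f_f y : (fun n => (f_ n y)%:E) @ \oo --> f y.
  exact: cvg_nnsfun_approx.
transitivity (limn (fun n => \int[nu]_y (f_ n y)%:E)).
  rewrite -monotone_convergence//.
  - by apply: eq_integral => y _; apply/esym/cvg_lim => //; exact: f_f.
  - by move=> n; exact/measurable_EFinP/measurable_funP.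
  - by move=> n y _; rewrite lee_fin.
  - by move=> y _ m n mn; rewrite lee_fin; exact/lefP/nd_nnsfun_approx.
transitivity (limn (fun n => \int[mu]_x (f_ n (phi x) * k x)%:E)); last first.
  rewrite -monotone_convergence//.
  - apply: eq_integral => x _; apply/cvg_lim => //.
    under eq_fun do rewrite EFinM.
    by apply: cvgeZr => //; exact: f_f.
  - move=> n; apply/measurable_EFinP; apply: measurable_funM => //.
    by apply: measurableT_comp => //; exact: measurable_funP.
  - by move=> n x _; rewrite lee_fin mulr_ge0.
  - move=> x _ m n mn; rewrite lee_fin ler_wpM2r//.
    exact/lefP/nd_nnsfun_approx.
congr (limn _); apply/funext => n.
have mF r : measurable (f_ n @^-1` [set r]) by [].
under eq_integral do rewrite fimfunE -fsumEFin//.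
rewrite ge0_integral_fsum//; last 2 first.
- by move=> y; exact/measurable_EFinP/measurable_funM.
- by move=> y x _; rewrite nnfun_muleindic_ge0.
transitivity (\sum_(r \in range (f_ n))
    \int[mu]_x (r * (\1_(f_ n @^-1` [set r]) (phi x) * k x))%:E); last first.
  rewrite -ge0_integral_fsum//.
  - apply: eq_integral => x _; rewrite (fimfunE _ (phi x)) EFinM -fsumEFin//.
    rewrite ge0_mule_fsuml//; first by apply: eq_fsbigr => r _; rewrite -EFinM mulrA.
    by move=> r; rewrite EFinM nnfun_muleindic_ge0.
  - move=> r; apply/measurable_EFinP; do 2 apply: measurable_funM => //.
    exact: measurableT_comp.
  - move=> r x _; rewrite mulrA EFinM mule_ge0 ?lee_fin// -lee_fin EFinM.
    exact: nnfun_muleindic_ge0.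
apply: eq_fsbigr => r _.
have mik : measurable_fun setT
    (fun x => \1_(f_ n @^-1` [set r]) (phi x) * k x)%R.
  by apply: measurable_funM => //; exact: measurableT_comp.
rewrite integralZl_indic_nnsfun// integral_indic// setIT nuE//.
have [r0|r0] := leP 0%R r.
  under [RHS]eq_integral do rewrite EFinM.
  rewrite ge0_integralZl//; first exact/measurable_EFinP.
  by move=> x _; rewrite lee_fin mulr_ge0.
rewrite preimage_nnfun0// indic0.
rewrite (eq_integral (fun=> 0)) => [|x _]; last by rewrite mul0r.
rewrite integral0 mule0 (eq_integral (fun=> 0)) ?integral0// => x _.
by rewrite mul0r mulr0.
Qed.

End change_of_variables.

(** * Lebesgue measure on tuples under homotheties *)

Section lebesgue_scaling.
Local Open Scope ereal_scope.
Context {R : realType}.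
Local Notation mu := (@lebesgue_measure R).

Let ge0_integral_scale1_gt0 (a : R) (f : R -> \bar R) : (0 < a)%R ->
  measurable_fun [set: measurableTypeR R] f -> (forall x, 0 <= f x) ->
  \int[mu]_x f x = a%:E * \int[mu]_x f (a * x)%R.
Proof.
move=> a0 mf f0.
have ma : measurable_fun setT ( *%R a : measurableTypeR R -> measurableTypeR R).
  exact: mulrl_measurable.
have muE A : measurable A -> mu A = a%:E * mu ( *%R a @^-1` A).
  move=> mA.
  apply: (@lebesgue_measure_unique R (mscale (NngNum (ltW a0))
    (pushforward mu ( *%R a : _ -> measurableTypeR R)))) => //.
  move=> _ [[u v]] _ <-; rewrite /mscale /pushforward /=.
  transitivity (a%:E * mu `](u / a)%R, (v / a)%R]); last first.
    congr (_ * mu _).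
    apply/seteqP; split => x /=; rewrite !in_itv/= ltr_pdivrMr// ler_pdivlMr//;
      by rewrite ![(a * x)%R]mulrC.
  rewrite !lebesgue_measure_itv/= !lte_fin ltr_pM2r ?invr_gt0//.
  case: ifPn => _; rewrite ?mule0// -EFinB -EFinM; congr (_%:E).
  by field; rewrite gt_eqF.
rewrite (@ge0_integral_density_pushforward _ _ _ _ _ mu mu ( *%R a) (fun=> a))//.
- by rewrite ge0_integralZr//; [rewrite muleC|exact: measurableT_comp|rewrite lee_fin ltW].
- by move=> x; exact: ltW.
- move=> A mA; under eq_integral do rewrite EFinM.
  have mA' : measurable ( *%R a @^-1` A : set (measurableTypeR R)).
    by rewrite -[X in measurable X]setTI; exact: ma.
  rewrite ge0_integralZr//; last 2 first.
  + by apply/measurable_EFinP/measurableT_comp.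
  + by rewrite lee_fin ltW.
  transitivity (a%:E * mu ( *%R a @^-1` A)); first exact: muE.
  rewrite muleC; congr (_ * _).
  by rewrite -[X in mu X]setIT -(integral_indic mu measurableT).
Qed.

Lemma ge0_integral_scale1 (a : R) (f : R -> \bar R) : a != 0%R ->
  measurable_fun [set: measurableTypeR R] f -> (forall x, 0 <= f x) ->
  \int[mu]_x f x = `|a|%:E * \int[mu]_x f (a * x)%R.
Proof.
move=> + mf f0; case: (ltgtP a 0%R) => // [alt0|agt0] _.
- rewrite (ltr0_norm alt0).
  have -> : \int[mu]_x f x = \int[mu]_x f (- x)%R.
    transitivity (\int[pushforward mu (-%R : _ -> measurableTypeR R)]_x f x).
      by apply: eq_measure_integral => //= A mA _; exact/esym/lebesgue_measureN.
    by rewrite ge0_integral_pushforward.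
  rewrite (@ge0_integral_scale1_gt0 (- a)%R) ?oppr_gt0//.
  + by under eq_integral do rewrite /= mulNr opprK.
  + by apply: measurableT_comp.
- by rewrite gtr0_norm//; exact: ge0_integral_scale1_gt0.
Qed.

Definition scalet n (a : R) (x : n.-tuple R) : n.-tuple R :=
  [tuple (a * tnth x i)%R | i < n].

Lemma measurable_scalet n (a : R) : measurable_fun setT (@scalet n a).
Proof.
apply/measurable_fun_tnthP => i.
rewrite (_ : _ \o _ = fun x => (a * tnth x i)%R).
  by apply: measurable_funM => //; exact: measurable_tnth.
by apply/funext => x /=; rewrite tnth_mktuple.
Qed.

Let measurable_cons_pairR n :
  measurable_fun [set: measurableTypeR R * n.-tuple R] (@cons_pair R n).
Proof. exact: measurable_cons_pair. Qed.

Let measurable_slice_integral n (f : n.+1.-tuple R -> \bar R) :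
  measurable_fun setT f -> (forall x, 0 <= f x) ->
  measurable_fun [set: measurableTypeR R]
    (fun b => \int[lebesgue_tuple n]_y f (cons_pair (b, y))).
Proof.
move=> mf f0.
apply: (measurable_fun_fubini_tonelli_F (f \o @cons_pair R n)) => [|x].
  exact: measurableT_comp mf (@measurable_cons_pairR n).
exact: f0.
Qed.

(** Tonelli's theorem for the recursive definition of Lebesgue measure, in the
    form that allows inductions on the dimension. *)
Lemma ge0_integral_lebesgue_tupleS n (f : n.+1.-tuple R -> \bar R) :
  measurable_fun setT f -> (forall x, 0 <= f x) ->
  \int[lebesgue_tuple n.+1]_x f x =
  \int[mu]_a \int[lebesgue_tuple n]_y f (cons_pair (a, y)).
Proof.
move=> mf f0; have mc := @measurable_cons_pairR n.
transitivity (\int[mu \x lebesgue_tuple n]_p (f \o @cons_pair R n) p).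
  have H := @ge0_integral_pushforward _ _ _ _ R _ mc (mu \x lebesgue_tuple n)
    setT f measurableT mf.
  by rewrite preimage_setT in H; rewrite -H.
have H := @fubini_tonelli1 _ _ _ _ R mu (lebesgue_tuple n) _
  (measurableT_comp mf mc).
by apply: H => p; exact: f0.
Qed.

Lemma scalet_cons n (a b : R) (y : n.-tuple R) :
  scalet a (cons_pair (b, y)) = cons_pair ((a * b)%R, scalet a y).
Proof.
apply: eq_from_tnth => i; rewrite tnth_mktuple.
have [j ->|->//] := unliftP ord0 i.
by rewrite !tnthS tnth_mktuple.
Qed.

(** One coordinate at a time, each contributing a factor |a|. Both a > 0
    (homotheties) and a = -1 (central symmetry) are needed. *)
Lemma ge0_integral_scalet n (a : R) (f : n.-tuple R -> \bar R) : a != 0%R ->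
  measurable_fun setT f -> (forall x, 0 <= f x) ->
  \int[lebesgue_tuple n]_x f x =
  (`|a| ^+ n)%:E * \int[lebesgue_tuple n]_x f (scalet a x).
Proof.
move=> a0; elim: n f => [f mf f0|n ih f mf f0].
  rewrite expr0 mul1e; apply: eq_integral => x _; congr (f _).
  by rewrite tuple0 [RHS]tuple0.
rewrite !ge0_integral_lebesgue_tupleS//; last first.
  by apply: measurableT_comp => //; exact: measurable_scalet.
rewrite (ge0_integral_scale1 a0); last 2 first.
- exact: measurable_slice_integral.
- by move=> b; exact: integral_ge0.
have mfa : measurable_fun setT (f \o @scalet n.+1 a).
  by apply: measurableT_comp => //; exact: measurable_scalet.
rewrite exprS EFinM -muleA; congr (_ * _).
rewrite -ge0_integralZl//; last 2 first.
- exact: (measurable_slice_integral mfa (fun x => f0 _)).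
- by move=> b _; exact: integral_ge0.
apply: eq_integral => b _.
rewrite ih//.
  by congr (_ * _); apply: eq_integral => y _; rewrite scalet_cons.
by apply: measurableT_comp => //; exact: measurableT_comp (@measurable_cons_pair R n) (pair1_measurable _).
Qed.

End lebesgue_scaling.

(** * Polar coordinates *)

Section euclidean_norm.
Context {R : realType} (d : nat).
Implicit Types x : d.-tuple R.

Lemma enorm_ge0 x : 0 <= enorm x.
Proof. exact: sqrtr_ge0. Qed.

Lemma sqr_enorm x : enorm x ^+ 2 = \sum_(i < d) tnth x i ^+ 2.
Proof. by rewrite sqr_sqrtr// sumr_ge0// => i _; exact: sqr_ge0. Qed.

Lemma enorm_scalet a x : enorm (scalet a x) = `|a| * enorm x.
Proof.
rewrite /enorm; under eq_bigr do rewrite tnth_mktuple exprMn.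
by rewrite -mulr_sumr sqrtrM ?sqr_ge0// sqrtr_sqr.
Qed.

Lemma directionE x : direction x = scalet (enorm x)^-1 x.
Proof. by apply: eq_from_tnth => i; rewrite !tnth_mktuple mulrC. Qed.

Lemma enorm_direction x : enorm x != 0 -> enorm (direction x) = 1.
Proof.
move=> x0; rewrite directionE enorm_scalet ger0_norm ?invr_ge0 ?enorm_ge0//.
exact: mulVf.
Qed.

Lemma direction_scalet a x : 0 < a -> direction (scalet a x) = direction x.
Proof.
move=> a0; apply: eq_from_tnth => i; rewrite !tnth_mktuple enorm_scalet.
by rewrite gtr0_norm// -mulf_div divff ?mul1r// gt_eqF.
Qed.

Lemma directionN x : direction (scalet (-1) x) = scalet (-1) (direction x).
Proof.
apply: eq_from_tnth => i; rewrite !tnth_mktuple enorm_scalet normrN1.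
by rewrite mul1r mulrA.
Qed.

(** This holds also at x = 0, where both sides vanish. *)
Lemma scalet_direction x : scalet (enorm x) (direction x) = x.
Proof.
apply: eq_from_tnth => i; rewrite !tnth_mktuple.
have [x0|x0] := eqVneq (enorm x) 0; last by rewrite mulrC divfK.
rewrite x0 mul0r; apply/esym/eqP; rewrite -sqrf_eq0.
have /eqP := sqr_enorm x; rewrite x0 expr0n/= eq_sym psumr_eq0.
  by move=> /allP/(_ i); rewrite mem_index_enum => /(_ isT).
by move=> j _; exact: sqr_ge0.
Qed.

End euclidean_norm.

Section polar.
Local Open Scope ereal_scope.
Context {R : realType} (d : nat).
Local Notation L := (@lebesgue_tuple R d).
Implicit Types x y : d.-tuple R.

Let menorm : measurable_fun setT (@enorm R d) := @measurable_enorm R d.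
Let mdir : measurable_fun setT (@direction R d) := @measurable_direction R d.

Let menormV : measurable_fun setT (fun x => (enorm x)^-1)%R.
Proof.
rewrite (_ : (fun x => _) = (fun r => r `^ (-1))%R \o @enorm R d).
  by apply: measurableT_comp => //; exact: measurable_powR.
by apply/funext => x /=; rewrite powR_inv1// enorm_ge0.
Qed.

Lemma ge0_integral_enorm_scale (h : R -> R) (a : R) : (0 < a)%R ->
  measurable_fun setT h -> (forall r, (0 <= h r)%R) ->
  \int[L]_y (h (enorm y))%:E = (a ^+ d)%:E * \int[L]_y (h (a * enorm y)%R)%:E.
Proof.
move=> a0 mh h0.
rewrite (@ge0_integral_scalet R d a)//.
- rewrite gtr0_norm//; congr (_ * _); apply: eq_integral => y _.
  by rewrite enorm_scalet gtr0_norm.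
- by rewrite gt_eqF.
- apply/measurable_EFinP; exact: measurableT_comp.
- by move=> y; rewrite lee_fin.
Qed.

(** Write the left-hand side as an integral over pairs (x, y). Replacing y by
    y / |x| turns psi |y| into psi (|y| / |x|), then replacing x by |y| x turns
    this into psi (1 / |x|) and h |x| into h (|x| |y|); finally replacing y by
    y / |x| restores h |y|. The first factor of the result no longer involves h,
    which is what separates the variables. The conditions at 0 dispose of the
    points x = 0 and y = 0, at which one cannot rescale. *)
Lemma polar_exchange (g : d.-tuple R -> R) (h psi : R -> R) :
  measurable_fun setT g -> measurable_fun setT h -> measurable_fun setT psi ->
  (forall x, (0 <= g x)%R) ->
  (forall r, (0 <= h r)%R) -> (forall r, (0 <= psi r)%R) ->
  h 0%R = 0%R -> psi 0%R = 0%R ->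
  \int[L]_x (g (direction x) * h (enorm x))%:E *
    \int[L]_y (psi (enorm y))%:E =
  \int[L]_x (g (direction x) * psi (enorm x)^-1 * (enorm x)^-1 ^+ (d + d))%:E *
    \int[L]_y (h (enorm y))%:E.
Proof.
move=> mg mh mpsi g0 h0 psi0 h00 psi00.
have n0 := @enorm_ge0 R d.
(* The integrands after the first and after the second rescaling. *)
pose F x y := (g (direction x) * h (enorm x) * (enorm x)^-1 ^+ d *
  psi (enorm y / enorm x))%R.
pose G x y := (g (direction x) * h (enorm x * enorm y) * (enorm x)^-1 ^+ d *
  psi (enorm x)^-1)%R.
have F0 x y : (0 <= F x y)%R by rewrite !mulr_ge0// exprn_ge0// invr_ge0.
have G0 x y : (0 <= G x y)%R by rewrite !mulr_ge0// exprn_ge0// invr_ge0.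
have mF : measurable_fun setT (fun p => F p.1 p.2).
  rewrite /F; apply: measurable_funM.
    apply: measurable_funM.
      apply: measurable_funM.
        by do 2 apply: measurableT_comp => //.
      by do 2 apply: measurableT_comp => //.
    apply: measurable_funX.
    exact: (measurableT_comp menormV).
  apply: measurableT_comp => //; apply: measurable_funM.
    exact: measurableT_comp.
  exact: (measurableT_comp menormV).
have mG : measurable_fun setT (fun p => G p.1 p.2).
  rewrite /G; apply: measurable_funM.
    apply: measurable_funM.
      apply: measurable_funM.
        by do 2 apply: measurableT_comp => //.
      apply: measurableT_comp => //; apply: measurable_funM.
        exact: measurableT_comp.
      exact: measurableT_comp.
    apply: measurable_funX.
    exact: (measurableT_comp menormV).
  apply: measurableT_comp => //.
  exact: (measurableT_comp menormV).
transitivity (\int[L]_x \int[L]_y (F x y)%:E).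
  rewrite -ge0_integralZr//; last 3 first.
  - apply/measurable_EFinP; apply: measurable_funM; exact: measurableT_comp.
  - by move=> x _; rewrite lee_fin mulr_ge0.
  - by apply: integral_ge0 => y _; rewrite lee_fin.
  apply: eq_integral => x _; rewrite -ge0_integralZl//; last 3 first.
  - by apply/measurable_EFinP; exact: measurableT_comp.
  - by move=> y _; rewrite lee_fin.
  - by rewrite lee_fin mulr_ge0.
  have [x0|x0] := eqVneq (enorm x) 0%R.
    apply: eq_integral => y _.
    by rewrite /F x0 h00 mulr0 !mul0r mul0e.
  have {}x0 : (0 < enorm x)%R by rewrite lt_def x0 n0.
  rewrite ge0_integralZl//; last 3 first.
  - by apply/measurable_EFinP; exact: measurableT_comp.
  - by move=> y _; rewrite lee_fin.
  - by rewrite lee_fin mulr_ge0.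
  rewrite (@ge0_integral_enorm_scale psi (enorm x)^-1)//; last by rewrite invr_gt0.
  rewrite muleA -EFinM -ge0_integralZl//; last 3 first.
  - apply/measurable_EFinP; apply: measurableT_comp => //.
    exact: measurable_funM.
  - by move=> y _; rewrite lee_fin.
  - by rewrite lee_fin !mulr_ge0// exprn_ge0// invr_ge0.
  by apply: eq_integral => y _; rewrite -EFinM /F (mulrC (enorm y)).
rewrite (fubini_tonelli (fun p => (F p.1 p.2)%:E))/=; last 2 first.
- exact/measurable_EFinP.
- by move=> p; rewrite lee_fin.
transitivity (\int[L]_y \int[L]_x (G x y)%:E).
  apply: eq_integral => y _.
  have mFy : measurable_fun setT (F ^~ y).
    exact: (measurableT_comp mF (pair2_measurable y)).
  have [y0|y0] := eqVneq (enorm y) 0%R.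
    apply: eq_integral => x _.
    by rewrite /F /G y0 mul0r mulr0 psi00 h00 !(mulr0, mul0r).
  have {}y0 : (0 < enorm y)%R by rewrite lt_def y0 n0.
  rewrite [LHS](@ge0_integral_scalet R d (enorm y)) ?gt_eqF//; last 2 first.
  - by apply/measurable_EFinP.
  - by move=> x; rewrite lee_fin.
  rewrite -ge0_integralZl//; last 2 first.
  - apply/measurable_EFinP.
    exact: (measurableT_comp mFy (@measurable_scalet R d _)).
  - by move=> x _; rewrite lee_fin.
  apply: eq_integral => x _; rewrite -EFinM; congr (_%:E).
  rewrite /F /G direction_scalet// enorm_scalet gtr0_norm//.
  have -> : (enorm y / (enorm y * enorm x) = (enorm x)^-1)%R.
    by rewrite invfM mulrA divff ?gt_eqF// mul1r.
  rewrite (mulrC (enorm y)) invfM exprMn.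
  rewrite !mulrA; congr (_ * _)%R.
  rewrite [LHS](_ : _ = (g (direction x) * h (enorm x * enorm y) *
    (enorm x)^-1 ^+ d) * (enorm y ^+ d * (enorm y)^-1 ^+ d))%R; last by ring.
  by rewrite -exprMn divff ?gt_eqF// expr1n mulr1.
rewrite -(fubini_tonelli (fun p => (G p.1 p.2)%:E))/=; last 2 first.
- exact/measurable_EFinP.
- by move=> p; rewrite lee_fin.
rewrite -ge0_integralZr//; last 3 first.
- apply/measurable_EFinP; apply: measurable_funM.
    by apply: measurable_funM; exact: measurableT_comp.
  by apply: measurable_funX.
- by move=> x _; rewrite lee_fin !mulr_ge0// exprn_ge0// invr_ge0.
- by apply: integral_ge0 => y _; rewrite lee_fin.
apply: eq_integral => x _.
have [x0|x0] := eqVneq (enorm x) 0%R.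
  (* As 0^-1 = 0, the argument of psi is 0 here. *)
  rewrite x0 invr0 psi00 mulr0 !mul0r mul0e integral0_eq// => y _.
  by rewrite /G x0 invr0 psi00 mulr0.
have {}x0 : (0 < enorm x)%R by rewrite lt_def x0 n0.
rewrite (@ge0_integral_enorm_scale h (enorm x))//.
rewrite muleA -EFinM -ge0_integralZl//; last 3 first.
- apply/measurable_EFinP; apply: measurableT_comp => //.
  exact: measurable_funM.
- by move=> y _; rewrite lee_fin.
- by rewrite lee_fin !mulr_ge0// exprn_ge0// invr_ge0.
apply: eq_integral => y _; rewrite -EFinM /G; congr (_%:E).
rewrite exprD.
rewrite [RHS](_ : _ = g (direction x) * h (enorm x * enorm y)
   * (enorm x)^-1 ^+ d * psi (enorm x)^-1 *
   ((enorm x)^-1 ^+ d * enorm x ^+ d))%R; last by ring.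
by rewrite -exprMn mulVf ?gt_eqF// expr1n mulr1.
Qed.

End polar.

(** * Integration on the sphere *)

Section sphere_integral.
Local Open Scope ereal_scope.
Context {R : realType} (d : nat).
Hypothesis d_gt0 : (0 < d)%N.
Local Notation L := (@lebesgue_tuple R d).
Implicit Types x y : d.-tuple R.

Let menorm : measurable_fun setT (@enorm R d) := @measurable_enorm R d.
Let mdir : measurable_fun setT (@direction R d) := @measurable_direction R d.

(** Used as a function of the radius: composed with the norm it is the
    indicator of the punctured unit ball. *)
Definition ball_ind (r : R) : R := \1_(`]0%R, 1%R[%classic : set R) r.

Definition ball_volume : R := fine (L (@punctured_ball R d)).

Lemma ball_ind0 : ball_ind 0 = 0%R.
Proof. by rewrite /ball_ind indicE memNset//= in_itv/= ltxx. Qed.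

Lemma ball_ind_ge0 r : (0 <= ball_ind r)%R.
Proof. by rewrite /ball_ind indicE. Qed.

Lemma measurable_ball_ind : measurable_fun setT ball_ind.
Proof. exact: measurable_indic. Qed.

Lemma ball_ind_enorm x : ball_ind (enorm x) = \1_(@punctured_ball R d) x.
Proof. by []. Qed.

Lemma surface_setT : @surface_measure R d setT = d%:R%:E * L (@punctured_ball R d).
Proof.
rewrite /surface_measure; congr (_ * L _).
by apply/seteqP; split => x /= => [[]|].
Qed.

Lemma ball_volumeE : L (@punctured_ball R d) = ball_volume%:E.
Proof.
have /andP[_] := @surface_measure_gt0_lty R d d_gt0; rewrite surface_setT => Doo.
rewrite fineK// ge0_fin_numE//; rewrite ltNge leye_eq; apply/eqP => Loo.
by move: Doo; rewrite Loo mulry gtr0_sg ?ltr0n// mul1e.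
Qed.

Lemma ball_volume_gt0 : (0 < ball_volume)%R.
Proof.
have /andP[+ _] := @surface_measure_gt0_lty R d d_gt0.
by rewrite surface_setT ball_volumeE -EFinM lte_fin pmulr_rgt0// ltr0n.
Qed.

Lemma integral_ball_ind : \int[L]_y (ball_ind (enorm y))%:E = ball_volume%:E.
Proof.
under eq_integral do rewrite ball_ind_enorm.
rewrite integral_indic//; last exact: measurable_punctured_ball.
by rewrite setIT; exact: ball_volumeE.
Qed.

Lemma measurable_sphere : measurable (@sphere R d).
Proof.
rewrite (_ : @sphere R d = @enorm R d @^-1` [set 1%R])//.
by rewrite -[X in measurable X]setTI; exact: menorm.
Qed.

Lemma sphere_measureE (A : set (d.-tuple R)) : measurable A ->
  sphere_measure d A =
  \int[L]_x (\1_A (direction x) * (ball_volume^-1 * ball_ind (enorm x)))%:E.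
Proof.
move=> mA.
have V0 := ball_volume_gt0.
rewrite /sphere_measure/= /mnormalize.
have /andP[D0 Doo] := @surface_measure_gt0_lty R d d_gt0.
rewrite (gt_eqF D0) (lt_eqF Doo)/= surface_setT ball_volumeE.
have mdA : measurable (@direction R d @^-1` A).
  by rewrite -[X in measurable X]setTI; exact: mdir.
have mB := @measurable_punctured_ball R d.
transitivity (ball_volume^-1%:E *
    \int[L]_x (\1_(@punctured_ball R d `&` @direction R d @^-1` A) x)%:E).
  rewrite integral_indic ?setIT//; last exact: measurableI.
  rewrite /surface_measure -EFinM/=.
  rewrite -[LHS]muleC muleA -EFinM; congr (_%:E * L _).
  by rewrite invfM mulrAC mulVf ?mul1r// pnatr_eq0 -lt0n.
rewrite -ge0_integralZl//; last 2 first.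
- by apply/measurable_EFinP/measurable_indic; exact: measurableI.
- by rewrite lee_fin invr_ge0 ltW.
apply: eq_integral => x _; rewrite -EFinM; congr (_%:E).
rewrite ball_ind_enorm mulrCA; congr (_ * _)%R.
by rewrite setIC indicI.
Qed.

Lemma ge0_integral_sphere (f : d.-tuple R -> \bar R) :
  measurable_fun setT f -> (forall x, 0 <= f x) ->
  \int[sphere_measure d]_(x in @sphere R d) f x =
  ball_volume^-1%:E * \int[L]_x (f (direction x) * (ball_ind (enorm x))%:E).
Proof.
move=> mf f0; have V0 := ball_volume_gt0.
have mS := measurable_sphere.
have mfd : measurable_fun setT (f \o @direction R d) by exact: measurableT_comp.
have mb : measurable_fun setT (fun x => ball_ind (enorm x)).
  by apply: measurableT_comp => //; exact: measurable_ball_ind.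
rewrite integral_mkcond.
rewrite (@ge0_integral_density_pushforward _ _ _ _ R L (sphere_measure d)
  (@direction R d) (fun x => ball_volume^-1 * ball_ind (enorm x))%R)//.
- rewrite -ge0_integralZl//; last 3 first.
  + by apply: emeasurable_funM => //; exact/measurable_EFinP.
  + by move=> x _; rewrite mule_ge0// lee_fin ball_ind_ge0.
  + by rewrite lee_fin invr_ge0 ltW.
  apply: eq_integral => x _; rewrite EFinM muleCA; congr (_ * _).
  have [x0|x0] := eqVneq (enorm x) 0%R; first by rewrite x0 ball_ind0 !mule0.
  by rewrite patchE mem_set//; exact: enorm_direction.
- exact: measurable_funM.
- by move=> x; rewrite mulr_ge0 ?invr_ge0 ?(ltW V0)// ball_ind_ge0.
- exact: sphere_measureE.
- by apply/(measurable_restrictT _ _).1 => //; exact: measurable_funS mf.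
- by move=> x; rewrite patchE; case: ifP.
Qed.

Lemma ge0_integral_sphere_ball (g : d.-tuple R -> R) :
  measurable_fun setT g -> (forall x, (0 <= g x)%R) ->
  \int[L]_x (g (direction x) * ball_ind (enorm x))%:E =
  ball_volume%:E * \int[sphere_measure d]_(x in @sphere R d) (g x)%:E.
Proof.
move=> mg g0; rewrite ge0_integral_sphere//; last exact/measurable_EFinP.
rewrite muleA -EFinM divff ?gt_eqF ?ball_volume_gt0// mul1e.
by apply: eq_integral => x _; rewrite EFinM.
Qed.

(** [polar_exchange] with psi the indicator of the ball, whose unknown constant
    is computed by the instance h = psi. *)
Lemma ge0_integral_polar (g : d.-tuple R -> R) (h : R -> R) :
  measurable_fun setT g -> measurable_fun setT h ->
  (forall x, (0 <= g x)%R) -> (forall r, (0 <= h r)%R) -> h 0%R = 0%R ->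
  \int[L]_x (g (direction x) * h (enorm x))%:E =
  \int[sphere_measure d]_(x in @sphere R d) (g x)%:E *
  \int[L]_y (h (enorm y))%:E.
Proof.
move=> mg mh g0 h0 h00; have V0 := ball_volume_gt0.
have b0 := ball_ind_ge0.
have mb := measurable_ball_ind.
have VK (a b : \bar R) : a * ball_volume%:E = b * ball_volume%:E -> a = b.
  move=> ab; rewrite -[a]mule1 -[b]mule1 -(_ : (ball_volume / ball_volume)%:E = 1).
    by rewrite EFinM !muleA ab.
  by rewrite divff ?gt_eqF.
have := @polar_exchange R d g h ball_ind mg mh mb g0 h0 b0 h00 ball_ind0.
have := @polar_exchange R d g ball_ind ball_ind mg mb mb g0 b0 b0 ball_ind0 ball_ind0.
rewrite integral_ball_ind => /VK <-; rewrite ge0_integral_sphere_ball// => e.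
by apply: VK; rewrite e -muleA muleC.
Qed.

(** Lebesgue measure and the unit ball are centrally symmetric. *)
Lemma ge0_integral_sphereN (g : d.-tuple R -> R) :
  measurable_fun setT g -> (forall x, (0 <= g x)%R) ->
  \int[sphere_measure d]_(x in @sphere R d) (g (scalet (-1) x))%:E =
  \int[sphere_measure d]_(x in @sphere R d) (g x)%:E.
Proof.
move=> mg g0; have ms := @measurable_scalet R d (-1).
rewrite [RHS]ge0_integral_sphere//; last exact/measurable_EFinP.
rewrite [LHS]ge0_integral_sphere; last 2 first.
- by apply/measurable_EFinP; exact: measurableT_comp.
- by move=> x; rewrite lee_fin.
congr (_ * _); rewrite [RHS](@ge0_integral_scalet R d (-1))//.
- rewrite normrN1 expr1n mul1e; apply: eq_integral => x _.
  by rewrite directionN enorm_scalet normrN1 mul1r.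
- apply: emeasurable_funM.
    by apply/measurable_EFinP; exact: measurableT_comp.
  apply/measurable_EFinP; apply: measurableT_comp => //.
  exact: measurable_ball_ind.
- by move=> x; rewrite mule_ge0 ?lee_fin ?ball_ind_ge0.
Qed.

End sphere_integral.

(** * The Gaussian measure in polar coordinates *)

Section gaussian_polar.
Local Open Scope ereal_scope.
Context {R : realType} (d : nat).
Hypothesis d_gt0 : (0 < d)%N.
Local Notation L := (@lebesgue_tuple R d).
Implicit Types x y : d.-tuple R.

Let menorm : measurable_fun setT (@enorm R d) := @measurable_enorm R d.
Let mdir : measurable_fun setT (@direction R d) := @measurable_direction R d.

Let measurable_density :
  measurable_fun setT (fun x : d.-tuple R => expR (- (pi * enorm x ^+ 2))%R).
Proof.
apply: measurableT_comp => //; apply: measurableT_comp => //.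
by apply: measurable_funM => //; exact: measurable_funX.
Qed.

Lemma ge0_integral_gaussian (f : d.-tuple R -> \bar R) :
  measurable_fun setT f -> (forall x, 0 <= f x) ->
  \int[@gaussian_measure R d]_x f x =
  \int[L]_x (f x * (expR (- (pi * enorm x ^+ 2)))%:E).
Proof.
move=> mf f0.
rewrite (@ge0_integral_density_pushforward _ _ _ _ R L (@gaussian_measure R d)
  idfun (fun x => expR (- (pi * enorm x ^+ 2)))%R)//.
- exact: measurable_id.
- move=> A mA; rewrite /= /gaussian_measure integral_mkcond.
  apply: eq_integral => x _; rewrite patchE indicE /=.
  by case: ifP; rewrite ?mul1r ?mul0r.
Qed.

(** The Gaussian density is absorbed in the radial factor. The hypothesis 0 < s
    makes this factor vanish at 0. *)
Lemma ge0_integral_gaussian_polar (g : d.-tuple R -> R) (s : nat) : (0 < s)%N ->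
  measurable_fun setT g -> (forall x, (0 <= g x)%R) ->
  \int[@gaussian_measure R d]_x (g (direction x) * enorm x ^+ s)%:E =
  \int[sphere_measure d]_(x in @sphere R d) (g x)%:E *
  \int[@gaussian_measure R d]_x (enorm x ^+ s)%:E.
Proof.
move=> s0 mg g0.
have ms : measurable_fun setT (fun x : d.-tuple R => enorm x ^+ s)%R.
  exact: measurable_funX.
have es0 x : (0 <= enorm x ^+ s)%R by rewrite exprn_ge0// enorm_ge0.
rewrite [in RHS]ge0_integral_gaussian; last 2 first.
- exact/measurable_EFinP.
- by move=> x; rewrite lee_fin.
rewrite ge0_integral_gaussian; last 2 first.
- by apply/measurable_EFinP; apply: measurable_funM => //; exact: measurableT_comp.
- by move=> x; rewrite lee_fin mulr_ge0.
pose h (r : R) := (`|r| ^+ s * expR (- (pi * r ^+ 2)))%R.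
have hE x : h (enorm x) = (enorm x ^+ s * expR (- (pi * enorm x ^+ 2)))%R.
  by rewrite /h ger0_norm// enorm_ge0.
have mh : measurable_fun setT h.
  apply: measurable_funM; first exact: measurable_funX.
  apply: measurableT_comp => //; apply: measurableT_comp => //.
  by apply: measurable_funM => //; exact: measurable_funX.
transitivity (\int[L]_x (g (direction x) * h (enorm x))%:E).
  by apply: eq_integral => x _; rewrite hE -EFinM mulrA.
rewrite ge0_integral_polar//.
- by congr (_ * _); apply: eq_integral => x _; rewrite hE EFinM.
- by move=> r; rewrite mulr_ge0 ?expR_ge0// exprn_ge0.
- by rewrite /h normr0 expr0n gtn_eqF//= mul0r.
Qed.

Lemma integral_gaussian_polar (g : d.-tuple R -> R) (s : nat) (C : R) :
  (0 < s)%N -> measurable_fun setT g -> 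
  (sphere_measure d).-integrable (@sphere R d) (EFin \o g) ->
  \int[@gaussian_measure R d]_x (enorm x ^+ s)%:E = C%:E ->
  \int[@gaussian_measure R d]_x (g (direction x) * enorm x ^+ s)%:E =
  \int[sphere_measure d]_(x in @sphere R d) (g x)%:E * C%:E.
Proof.
move=> s0 mg ig CE.
have mS := @measurable_sphere R d.
have es0 x : (0 <= enorm x ^+ s)%R by rewrite exprn_ge0// enorm_ge0.
rewrite integralE [in RHS]integralE.
rewrite muleBl//; last first.
  by rewrite fin_num_adde_defl// fin_numN integrable_neg_fin_num.
have posE : (fun x => (g (direction x) * enorm x ^+ s)%:E)^\+ =
    (fun x => (g^\+%R (direction x) * enorm x ^+ s)%:E).
  rewrite (funerpos (fun x => g (direction x) * enorm x ^+ s)%R).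
  by apply/funext => x; rewrite /= /funrpos /funrneg maxr_pMl// mul0r.
have negE : (fun x => (g (direction x) * enorm x ^+ s)%:E)^\- =
    (fun x => (g^\-%R (direction x) * enorm x ^+ s)%:E).
  rewrite (funerneg (fun x => g (direction x) * enorm x ^+ s)%R).
  by apply/funext => x; rewrite /= /funrpos /funrneg maxr_pMl// mul0r mulNr.
rewrite posE negE !ge0_integral_gaussian_polar//.
- by rewrite CE (funerpos g) (funerneg g).
- exact: measurable_funrneg.
- exact: measurable_funrpos.
Qed.

(** The integrand is positive on the punctured unit ball, which has positive
    volume. *)
Lemma moment_gt0 (s : nat) (C : R) :
  \int[@gaussian_measure R d]_x (enorm x ^+ s)%:E = C%:E -> (0 < C)%R.
Proof.
have es0 x : (0 <= enorm x ^+ s)%R by rewrite exprn_ge0// enorm_ge0.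
have ms : measurable_fun setT (fun x : d.-tuple R => enorm x ^+ s)%R.
  exact: measurable_funX.
move=> CE; rewrite lt_def -lee_fin -CE integral_ge0 ?andbT => [|x _]; last first.
  by rewrite lee_fin.
apply/eqP => C0; move: CE; rewrite C0 ge0_integral_gaussian; last 2 first.
- exact/measurable_EFinP.
- by move=> x; rewrite lee_fin.
set F := (F in \int[_]_x F x) => F0.
have F_ge0 x : 0 <= F x by rewrite /F -EFinM lee_fin mulr_ge0// expR_ge0.
have mF : measurable_fun setT F.
  by apply: emeasurable_funM; exact/measurable_EFinP.
have /(ae_eq_integral_abs L measurableT mF) : \int[L]_x `|F x| = 0.
  by under eq_integral do rewrite gee0_abs//.
move=> [A [mA A0 FA]].
have BA : @punctured_ball R d `<=` A.
  move=> x /andP[x0 _]; apply: FA => /= /(_ I); rewrite /F -EFinM => -[].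
  by apply/eqP; rewrite mulf_neq0 ?gt_eqF ?exprn_gt0 ?expR_gt0.
have := @ball_volume_gt0 R d d_gt0.
rewrite ltNge -lee_fin -ball_volumeE// => /negP; apply.
rewrite -[leRHS]A0 le_measure ?inE//; exact: measurable_punctured_ball.
Qed.

End gaussian_polar.

(** * Monomials on the sphere and antipodal symmetrization *)

Section monomials.
Context {R : realType} (d : nat).
Implicit Types (x : d.-tuple R) (m : multinom d).

Definition monomial m x : R := \prod_(i < d) tnth x i ^+ m i.

Lemma pevalE (p : mpoly d R) x :
  peval p x = \sum_(m <- msupp p) mcoeff m p * monomial m x.
Proof. exact: mevalE. Qed.

Lemma measurable_monomial m : measurable_fun setT (monomial m).
Proof.
apply: measurable_prod => i _; apply: measurable_funX; exact: measurable_tnth.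
Qed.

Lemma monomial_scalet m a x :
  monomial m (scalet a x) = a ^+ mdeg m * monomial m x.
Proof.
rewrite /monomial mdegE -prodrXr -big_split/=.
by apply: eq_bigr => i _; rewrite tnth_mktuple exprMn.
Qed.

Lemma monomial_polar m x :
  monomial m x = enorm x ^+ mdeg m * monomial m (direction x).
Proof. by rewrite -monomial_scalet scalet_direction. Qed.

Lemma monomial_le1 m x : sphere x -> `|monomial m x| <= 1.
Proof.
move=> x1; rewrite normr_prod; apply: prodr_ile1 => i _.
rewrite normr_ge0 normrX exprn_ile1//.
rewrite -x1 -sqrtr_sqr ler_wsqrtr// (bigD1 i)//= lerDl.
by rewrite sumr_ge0// => j _; rewrite sqr_ge0.
Qed.

Lemma integrable_monomial m :
  (sphere_measure d).-integrable (@sphere R d) (EFin \o monomial m).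
Proof.
have mS := @measurable_sphere R d.
apply: (@le_integrable _ _ _ _ _ mS _ (EFin \o cst 1)).
- by apply/measurable_EFinP; apply: measurable_funTS; exact: measurable_monomial.
- by move=> x Sx; rewrite /= lee_fin normr1 monomial_le1.
- exact: finite_measure_integrable_cst.
Qed.

(** The antipodal map exchanges the positive and the negative part of an odd
    function. *)
Lemma integral_sphere_odd_monomial m : (0 < d)%N -> odd (mdeg m) ->
  (\int[sphere_measure d]_(x in @sphere R d) (monomial m x)%:E = 0)%E.
Proof.
move=> d0 om.
have mS := @measurable_sphere R d.
have mm := measurable_monomial m.
rewrite integralE (funerpos (monomial m)) (funerneg (monomial m)).
rewrite -(@ge0_integral_sphereN R d d0 ((monomial m)^\+%R)); last 2 first.
- exact: measurable_funrpos.
- by move=> x; exact: funrpos_ge0.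
rewrite [X in (X - _)%E](_ : _ = \int[sphere_measure d]_(x in @sphere R d)
    ((monomial m)^\-%R x)%:E)%E.
  have := integrable_neg_fin_num mS (integrable_monomial m).
  by rewrite (funerneg (monomial m)) => /subee.
apply: eq_integral => x _ /=.
by rewrite /funrpos /funrneg monomial_scalet -signr_odd om expr1 mulN1r.
Qed.

Lemma sphere_measure_sphere : (0 < d)%N -> sphere_measure d (@sphere R d) = 1%E.
Proof.
move=> d0; have mS := @measurable_sphere R d.
have mSC : measurable (~` @sphere R d) by exact: measurableC.
have := probability_setC (sphere_measure d) mSC; rewrite setCK => ->.
suff -> : sphere_measure d (~` @sphere R d) = 0%E by rewrite sube0.
rewrite sphere_measureE//.
rewrite integral0_eq// => x _; apply/eqP; rewrite eqe.
have [x0|x0] := eqVneq (enorm x) 0; first by rewrite x0 ball_ind0 !mulr0.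
by rewrite indicE memNset ?mul0r//= => /(_ (enorm_direction x0)).
Qed.

End monomials.

Section symmetrization.
Context {R : realType} (d : nat).
Hypothesis d_gt0 : (0 < d)%N.
Implicit Types (y : d.-tuple R) (m : multinom d).

Local Notation neg := (@scalet R d (-1)).

Lemma spherical_design_monomials t (Y : {fset d.-tuple R}) (v : d.-tuple R -> R) :
  (forall y, y \in Y -> sphere y) -> (forall y, y \in Y -> 0 < v y) ->
  (forall m, (mdeg m <= t)%N -> (\sum_(y <- Y) v y * monomial m y)%:E =
    (\int[sphere_measure d]_(x in @sphere R d) (monomial m x)%:E)%E) ->
  spherical_design t Y v.
Proof.
move=> YS v0 vm; split => // p pt.
have mS := @measurable_sphere R d.
have im := @integrable_monomial R d.
under [RHS]eq_integral do rewrite pevalE -sumEFin.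
rewrite integral_sum//; last first.
  move=> m; under eq_fun do rewrite EFinM.
  exact: (integrableZl mS _ (im m)).
under eq_bigr do rewrite pevalE mulr_sumr.
rewrite exchange_big/= -sumEFin; apply: eq_big_seq => m mp.
under [RHS]eq_integral do rewrite EFinM.
rewrite (integralZl mS (im m)) -vm; last first.
  by rewrite -ltnS; exact: leq_trans (msize_mdeg_lt mp) pt.
by rewrite -EFinM mulr_sumr; congr (_%:E); apply: eq_bigr => y _; rewrite mulrCA.
Qed.

(** The points u x may collide with one another and with the antipodes, so the
    weight of y collects the contributions of all x with y = u x or
    y = - u x. *)
Lemma spherical_design_of_even_monomials t (T : choiceType) (X : {fset T})
    (u : T -> d.-tuple R) (a : T -> R) :
  (forall x, x \in X -> sphere (u x)) -> (forall x, x \in X -> 0 < a x) ->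
  (forall m, ~~ odd (mdeg m) -> (mdeg m <= t)%N ->
    (\sum_(x <- X) a x * monomial m (u x))%:E =
    (\int[sphere_measure d]_(x in @sphere R d) (monomial m x)%:E)%E) ->
  exists (Y : {fset d.-tuple R}) (v : d.-tuple R -> R),
    spherical_design t Y v /\ (#|` Y| <= 2 * #|` X|)%N.
Proof.
move=> uS a0 am.
pose Y := ([fset u x | x in X] `|` [fset neg (u x) | x in X])%fset.
pose v y := \sum_(x <- X) a x / 2 * ((u x == y)%:R + (neg (u x) == y)%:R).
have vE (f : d.-tuple R -> R) : \sum_(y <- Y) v y * f y =
    \sum_(x <- X) a x / 2 * (f (u x) + f (neg (u x))).
  have pick z : z \in Y -> \sum_(y <- Y) (z == y)%:R * f y = f z.
    move=> zY; rewrite (bigD1_seq z)//= eqxx mul1r big1 ?addr0// => y.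
    by rewrite eq_sym => /negPf ->; rewrite mul0r.
  under eq_bigr do rewrite mulr_suml.
  rewrite exchange_big/=; apply: eq_big_seq => x xX.
  rewrite -(pick (u x)); last by apply/fsetUP; left; apply/imfsetP; exists x.
  rewrite -(pick (neg (u x))); last by apply/fsetUP; right; apply/imfsetP; exists x.
  rewrite -big_split/= mulr_sumr; apply: eq_bigr => y _.
  by rewrite -mulrA mulrDl.
exists Y, v; split.
  apply: spherical_design_monomials.
  - move=> y /fsetUP[] /imfsetP[x /= xX ->]; first exact: uS.
    by rewrite /sphere /= enorm_scalet normrN1 mul1r uS.
  - move=> y yY.
    have t0 x : x \in X -> 0 <= a x / 2 * ((u x == y)%:R + (neg (u x) == y)%:R).
      by move=> xX; rewrite mulr_ge0 ?addr_ge0 ?ler0n// divr_ge0 ?ler0n// ltW ?a0.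
    have [x xX xy] : exists2 x, x \in X & (u x == y) || (neg (u x) == y).
      move: yY => /fsetUP[] /imfsetP[x /= xX ->]; exists x => //.
        by rewrite eqxx.
      by rewrite eqxx orbT.
    rewrite /v (bigD1_seq x)//= ltr_pwDl//.
      rewrite mulr_gt0 ?divr_gt0 ?a0//.
      by case/orP: xy => ->; [rewrite ltr_pwDl|rewrite ltr_wpDl]; rewrite ?ler0n.
    by rewrite big_seq_cond sumr_ge0// => z /andP[zX _]; exact: t0.
  - move=> m mt; rewrite vE.
    have [om|em] := boolP (odd (mdeg m)).
      rewrite integral_sphere_odd_monomial// big1// => x _.
      by rewrite monomial_scalet -signr_odd om expr1 mulN1r subrr mulr0.
    rewrite -am//; congr (_%:E); apply: eq_bigr => x _.
    rewrite monomial_scalet -signr_odd (negPf em) expr0 mul1r.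
    by field.
rewrite mul2n -addnn cardfsU (leq_trans (leq_subr _ _))//.
by rewrite leq_add// leq_imfset_card.
Qed.

End symmetrization.

(** * From Gaussian to spherical designs *)

Section from_gaussian.
Context {R : realType} (d : nat).
Hypothesis d_gt0 : (0 < d)%N.
Implicit Types (x y : d.-tuple R) (m : multinom d).
Implicit Types (X : {fset d.-tuple R}) (w : d.-tuple R -> R).

Definition sqnorm_poly : mpoly d R := \sum_(i < d) mpolyX R (mnm1 i) ^+ 2.

Lemma peval_sqnorm_polyX j x : peval (sqnorm_poly ^+ j) x = enorm x ^+ (2 * j).
Proof.
rewrite /peval rmorphXn /sqnorm_poly rmorph_sum exprM sqr_enorm; congr (_ ^+ _).
by apply: eq_bigr => i _; rewrite rmorphXn/= mevalXU.
Qed.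

Lemma deg_le_monomial_sqnorm m j t : (mdeg m + 2 * j <= t)%N ->
  deg_le t (mpolyX R m * sqnorm_poly ^+ j).
Proof.
move=> mjt; rewrite /deg_le msizeE.
have : mpolyX R m * sqnorm_poly ^+ j \is ishomog1 (mdeg m + 2 * j) mdeg.
  apply: dhomogM; first by rewrite dhomogX.
  apply: dhomogMn; apply: rpred_sum => i _.
  rewrite -[2%N]/(1 * 2)%N; apply: dhomogMn.
  by rewrite dhomogX; apply/eqP; exact: mdeg1.
move=> /dhomogP h; apply/bigmax_leqP_seq => m' m'p _.
by rewrite h.
Qed.

Lemma gaussian_design_norm_moment t X w k : gaussian_design t X w ->
  (2 * k <= t)%N ->
  (\int[@gaussian_measure R d]_x (@enorm R d x ^+ (2 * k))%:E =
    (\sum_(x <- X) w x * enorm x ^+ (2 * k))%:E)%E.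
Proof.
move=> [_ Xw] kt; under eq_integral do rewrite -peval_sqnorm_polyX.
rewrite -Xw; first by under eq_bigr do rewrite peval_sqnorm_polyX.
by have := @deg_le_monomial_sqnorm mnm0 k t; rewrite mpolyX0 mul1r mdeg0; exact.
Qed.

(** The design is applied to the monomial times the power of |x|^2 that brings
    its degree to 2k. *)
Lemma gaussian_design_moments t X w k m : gaussian_design t X w ->
  (0 < k)%N -> (2 * k <= t)%N -> ~~ odd (mdeg m) -> (mdeg m <= 2 * k)%N ->
  (\sum_(x <- X) w x * enorm x ^+ (2 * k) * monomial m (direction x))%:E =
  (\int[sphere_measure d]_(x in @sphere R d) (monomial m x)%:E *
    (\sum_(x <- X) w x * enorm x ^+ (2 * k))%:E)%E.
Proof.
move=> D k0 kt em mk; have [w0 Xw] := D.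
rewrite -(integral_gaussian_polar d_gt0 _ (measurable_monomial m)
  (integrable_monomial m) (gaussian_design_norm_moment D kt)); last first.
  by rewrite muln_gt0.
pose j := (k - (mdeg m)./2)%N.
have mj : (mdeg m + 2 * j = 2 * k)%N.
  have := odd_double_half (mdeg m); rewrite (negPf em) /j; lia.
have qE x : peval (mpolyX R m * sqnorm_poly ^+ j) x =
    monomial m (direction x) * enorm x ^+ (2 * k).
  rewrite /peval rmorphM/= mevalX -/(monomial m x) -/(peval _ x).
  rewrite peval_sqnorm_polyX monomial_polar -mj exprD.
  by rewrite mulrAC mulrC.
under [RHS]eq_integral do rewrite -qE.
rewrite -Xw; last by apply: deg_le_monomial_sqnorm; rewrite mj.
by congr (_%:E); apply: eq_bigr => x _; rewrite qE mulrAC -mulrA (mulrC (monomial _ _)).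
Qed.

Lemma gaussian_moment_gt0 t X w k : gaussian_design t X w ->
  (2 * k <= t)%N -> 0 < \sum_(x <- X) w x * enorm x ^+ (2 * k).
Proof.
move=> D kt.
exact: (moment_gt0 d_gt0 (gaussian_design_norm_moment D kt)).
Qed.

(** The origin has no direction and is left out; since k > 0 it does not
    contribute to the sums. *)
Lemma spherical_design_of_gaussian t X w : (1 < t)%N -> gaussian_design t X w ->
  exists (Y : {fset d.-tuple R}) (v : d.-tuple R -> R),
    spherical_design t Y v /\ (#|` Y| <= 2 * #|` X|)%N.
Proof.
move=> t1 D; pose k := t./2.
have k0 : (0 < k)%N by rewrite /k; lia.
have kt : (2 * k <= t)%N by rewrite /k; lia.
pose C := \sum_(x <- X) w x * enorm x ^+ (2 * k).
have C0 : 0 < C := gaussian_moment_gt0 D kt.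
pose X' := [fset x in X | enorm x != 0]%fset.
have X'P x : x \in X' -> x \in X /\ enorm x != 0.
  by rewrite !inE /= => /andP[].
have X'X : (#|` X'| <= #|` X|)%N.
  by apply: fsubset_leq_card; apply/fsubsetP => x /X'P[].
have [x xX'|x xX'|m em mt|Y [v [Yv cardY]]] :=
    @spherical_design_of_even_monomials R d d_gt0 t _ X' (@direction R d)
      (fun x => w x * enorm x ^+ (2 * k) / C).
- by apply: enorm_direction; have [] := X'P _ xX'.
- have [xX x0] := X'P _ xX'; have [w0 _] := D.
  by rewrite divr_gt0// mulr_gt0 ?w0// exprn_gt0// lt_def x0 enorm_ge0.
- have mk : (mdeg m <= 2 * k)%N.
    by have := odd_double_half (mdeg m); rewrite (negPf em) /k; lia.
  have := gaussian_design_moments D k0 kt em mk; rewrite -/C => E.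
  have -> : (\int[sphere_measure d]_(x in @sphere R d) (monomial m x)%:E =
      (\sum_(x <- X) w x * enorm x ^+ (2 * k) * monomial m (direction x))%:E *
        C^-1%:E)%E.
    by rewrite E -muleA -EFinM divff ?gt_eqF// mule1.
  rewrite -EFinM mulr_suml; congr (_%:E).
  rewrite /X' big_fset/= big_mkcond/=; apply: eq_bigr => x _.
  case: eqVneq => [->|_] /=; last by rewrite mulrAC.
  by rewrite expr0n muln_eq0/= gtn_eqF//= mulr0 !mul0r.
by exists Y, v; split => //; rewrite (leq_trans cardY)// leq_mul2l X'X orbT.
Qed.

(** Two antipodal points: the only even monomial of degree at most 1 is the
    constant. *)
Lemma exists_spherical_1design :
  exists (Y : {fset d.-tuple R}) (v : d.-tuple R -> R),
    spherical_design 1 Y v /\ (#|` Y| <= 2)%N.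
Proof.
pose e : d.-tuple R := [tuple (i == 0 :> nat)%:R | i < d].
have eS : sphere e.
  rewrite /sphere /= /enorm (bigD1 (Ordinal d_gt0))//= big1 ?addr0 => [|i i0].
    by rewrite tnth_mktuple eqxx expr1n sqrtr1.
  by rewrite tnth_mktuple (_ : (i == 0 :> nat) = false) ?expr0n//; apply/negbTE.
suff : exists (Y : {fset d.-tuple R}) v,
    spherical_design 1 Y v /\ (#|` Y| <= 2 * #|` [fset tt]%fset|)%N.
  by rewrite cardfs1 muln1.
apply: (@spherical_design_of_even_monomials R d d_gt0 1 unit [fset tt]%fset
  (fun=> e) (fun=> 1)) => // m em m1.
have m0 : mdeg m = 0%N by case: (mdeg m) em m1 => [|[]].
rewrite big_seq_fset1 mul1r.
have mE x : monomial m x = 1.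
  move: m0 => /eqP; rewrite mdeg_eq0 => /eqP ->.
  by rewrite /monomial big1// => i _; rewrite mnm0E.
under eq_integral do rewrite mE.
rewrite mE (integral_cst _ (@measurable_sphere R d)) mul1e.
by apply: esym; exact: sphere_measure_sphere.
Qed.

End from_gaussian.

Theorem proposition3p3 (R : realType) (t d N : nat)
    (ht : (0 < t)%N) (hd : (0 < d)%N) (hN : (0 < N)%N) :
  (exists (X : {fset d.-tuple R}) (w : d.-tuple R -> R),
    gaussian_design t X w /\ #|` X| = N) ->
  exists (Y : {fset d.-tuple R}) (v : d.-tuple R -> R),
    spherical_design t Y v /\ (#|` Y| <= 2 * N)%N.
Proof.
move=> [X [w [D XN]]]; have [t1|] := ltnP 1 t.
  by rewrite -XN; exact: spherical_design_of_gaussian t1 D.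
rewrite leq_eqVlt ltnS leqNgt ht orbF => /eqP ->.
have [Y [v [Yv cardY]]] := @exists_spherical_1design R d hd.
by exists Y, v; split => //; rewrite (leq_trans cardY)// leq_pmulr.
Qed.
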